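(* Let $n,k,m$ be integers with $1\le m\le k$ and $k+m\le n$. Let $\mathsf{UComp}_{n,k,m}$ be the set of pairs $(A,c)$ with $A$ a $(k-1)$-element subset of $\{1,\ldots,n\}$ and $c$ a composition of $n$ into exactly $k$ parts of which exactly $m$ are larger than $1$. Let $\mathcal{T}_{n,k,m}$ be the set of plane trees with $n$ edges and $k$ internal nodes, exactly $m$ of which have degree larger than $1$. Then there exists a map $\phi:\mathsf{UComp}_{n,k,m}\to\mathcal{T}_{n,k,m}$ such that every element of $\mathcal{T}_{n,k,m}$ has exactly $k$ preimages under $\phi$. Consequently $$|\mathcal{T}_{n,k,m}|=\frac{1}{k}|\mathsf{UComp}_{n,k,m}|=\frac{1}{k}\binom{n}{k-1}\binom{n-k-1}{m-1}\binom{k}{m}.$$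
   Context: A composition of $n$ into $k$ parts is a sequence $(c_1,\ldots,c_k)$ of positive integers summing to $n$. A plane tree is a rooted tree in which the children of each vertex are linearly ordered; the degree of a vertex is its number of children; an internal node is a vertex of degree at least $1$. *)

(* Defs.v *)
From HB Require Import structures.
From mathcomp Require Import all_boot all_order all_algebra.

Set Implicit Arguments.
Unset Strict Implicit.
Unset Printing Implicit Defensive.

Definition is_composition (n : nat) (c : seq nat) : bool :=
  all (fun x => 0 < x) c && (sumn c == n).

Record composition (n : nat) : Type := Composition {
  parts :> seq nat;
  _ : is_composition n parts
}.

HB.instance Definition _ n := [isSub for @parts n].
HB.instance Definition _ n := [Countable of composition n by <:].

Fixpoint bounded_seqs (n h : nat) : seq (seq nat) :=
  if h is h'.+1 then
    [::] :: [seq x :: c | x <- iota 1 n, c <- bounded_seqs n h']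
  else [:: [::]].

Lemma mem_bounded_seqs n h c :
  all (fun x => 0 < x <= n) c -> size c <= h -> c \in bounded_seqs n h.
Proof.
elim: h c => [|h IHh] [|x c] //= /andP[le_xn le_cn] le_ch.
rewrite in_cons /=; apply/allpairsP; exists (x, c) => /=.
by split; [rewrite mem_iota add1n ltnS | exact: IHh |].
Qed.

Lemma compositionP n c :
  is_composition n c -> all (fun x => 0 < x <= n) c && (size c <= n).
Proof.
case/andP=> pos_c /eqP <-; elim: c pos_c => //= x c IHc /andP[x_gt0 /IHc].
case/andP=> le_c sz_c; rewrite x_gt0 leq_addr (leq_add x_gt0 sz_c) andbT /=.
apply: sub_all le_c => y /andP[-> /leq_trans]; apply.
exact: leq_addl.
Qed.

Definition composition_enum n : seq (composition n) :=
  undup (pmap insub (bounded_seqs n n)).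

Lemma composition_enumP n : Finite.axiom (composition_enum n).
Proof.
move=> c; rewrite count_uniq_mem ?undup_uniq // mem_undup mem_pmap_sub /=.
by rewrite mem_bounded_seqs //; case/andP: (compositionP (valP c)).
Qed.

HB.instance Definition _ n :=
  isFinite.Build (composition n) (@composition_enumP n).

(** A plane tree is its root together with the ordered list of the subtrees
    hanging from the root. *)
Inductive ptree : Type := PNode of seq ptree.

Fixpoint ptree_encode (t : ptree) : GenTree.tree unit :=
  let: PNode s := t in GenTree.Node 0 (map ptree_encode s).

Fixpoint ptree_decode (u : GenTree.tree unit) : ptree :=
  if u is GenTree.Node _ s then PNode (map ptree_decode s) else PNode [::].

Lemma ptree_encodeK : cancel ptree_encode ptree_decode.
Proof.
rewrite /cancel; fix IH 1 => -[s] /=; congr PNode.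
by elim: s => //= t s ->; rewrite IH.
Qed.

HB.instance Definition _ := Countable.copy ptree (can_type ptree_encodeK).

(** Degrees (numbers of children) of all the vertices, in preorder. *)
Fixpoint degrees (t : ptree) : seq nat :=
  let: PNode s := t in size s :: flatten [seq degrees u | u <- s].

(** Each child [u] of the root contributes the edge joining it to the root and
    the edges of the subtree rooted at [u]. *)
Fixpoint nb_edges (t : ptree) : nat :=
  let: PNode s := t in sumn [seq (nb_edges u).+1 | u <- s].

Definition nb_internal (t : ptree) : nat := count (fun d => 1 <= d) (degrees t).

Definition nb_branching (t : ptree) : nat := count (fun d => 1 < d) (degrees t).

Record plane_tree (n : nat) : Type := PlaneTree {
  tree_of :> ptree;
  _ : nb_edges tree_of == n
}.

HB.instance Definition _ n := [isSub for @tree_of n].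
HB.instance Definition _ n := [Countable of plane_tree n by <:].

Fixpoint forests (h : nat) : seq (seq ptree) :=
  if h is h'.+1 then
    [::] :: [seq PNode s1 :: s2 | s1 <- forests h', s2 <- forests h']
  else [:: [::]].

Lemma mem_forests h s : nb_edges (PNode s) <= h -> s \in forests h.
Proof.
elim: h s => [|h IHh] [|[s1] s2] //.
rewrite -[nb_edges _]/((nb_edges (PNode s1)).+1 + nb_edges (PNode s2)) addSn ltnS => le_h; rewrite in_cons /=; apply/allpairsP.
exists (s1, s2); split=> //; apply: IHh; apply: leq_trans le_h.
  exact: leq_addr.
exact: leq_addl.
Qed.

Definition plane_tree_enum n : seq (plane_tree n) :=
  undup (pmap insub (map PNode (forests n))).

Lemma plane_tree_enumP n : Finite.axiom (plane_tree_enum n).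
Proof.
case=> -[s] es; rewrite count_uniq_mem ?undup_uniq // mem_undup mem_pmap_sub /=.
by rewrite map_f // mem_forests // (eqP es).
Qed.

HB.instance Definition _ n :=
  isFinite.Build (plane_tree n) (@plane_tree_enumP n).

(** The ground set {1, ..., n} is represented by ['I_n], [i] standing for
    [i + 1]. *)
Definition UComp (n k m : nat) : {set {set 'I_n} * composition n} :=
  [set x : {set 'I_n} * composition n |
     [&& #|x.1| == k - 1,
         size x.2 == k
       & count (fun p => 1 < p) x.2 == m]].

Definition Trees (n k m : nat) : {set plane_tree n} :=
  [set t : plane_tree n | (nb_internal t == k) && (nb_branching t == m)].

(* Main.v *)
Require Import Defs.
From HB Require Import structures.
From mathcomp Require Import all_boot all_order all_algebra.
From mathcomp Require Import zify.

Set Implicit Arguments.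
Unset Strict Implicit.
Unset Printing Implicit Defensive.

Import GRing.Theory Num.Theory.

(** A pair [(A, c)] is turned into the word of length [n + 1] that starts with
    [c_1], has [c_2, ..., c_k] at the positions of [A] and zeros elsewhere. By
    the cycle lemma, a word of length one more than its sum has exactly one
    rotation that is the preorder degree word of a plane tree, and [phi] maps
    [(A, c)] to that tree. The rotations of a degree word are pairwise distinct,
    and the preimages of a tree are those rotations of its degree word that
    start with one of its [k] nonzero letters. *)

(** * Degree words of forests and the Lukasiewicz condition *)

Definition forest_degrees (s : seq ptree) : seq nat :=
  flatten [seq degrees u | u <- s].

Lemma forest_degrees_cons s r :
  forest_degrees (PNode s :: r) =
  size s :: forest_degrees s ++ forest_degrees r.
Proof. by []. Qed.

(** Induction along the first-child, next-sibling decomposition; both smaller forests lose at least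
    one edge. *)
Lemma forest_ind (P : seq ptree -> Prop) :
    P [::] -> (forall s r, P s -> P r -> P (PNode s :: r)) ->
  forall s, P s.
Proof.
move=> P0 PS s; have [h le_h] := ubnP (nb_edges (PNode s)).
elim: h s le_h => // h IHh [|[s] r] //.
rewrite -[nb_edges _]/((nb_edges (PNode s)).+1 + nb_edges (PNode r)) => le_h.
by apply: PS; apply: IHh; lia.
Qed.

(** Each vertex is either one of the roots or a child of exactly one vertex. *)
Lemma size_forest_degrees s :
  size (forest_degrees s) = size s + sumn (forest_degrees s).
Proof.
elim/forest_ind: s => // s r IHs IHr.
by rewrite forest_degrees_cons /= size_cat sumn_cat IHs IHr; lia.
Qed.

Lemma nb_edges_forest s :
  nb_edges (PNode s) = size (forest_degrees s).
Proof.
elim/forest_ind: s => // s r IHs IHr.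
rewrite -[LHS]/((nb_edges (PNode s)).+1 + nb_edges (PNode r)) IHs IHr.
by rewrite forest_degrees_cons /= size_cat.
Qed.

Lemma size_degrees t : size (degrees t) = (nb_edges t).+1.
Proof. by case: t => s; rewrite nb_edges_forest. Qed.

Lemma sumn_degrees t : sumn (degrees t) = nb_edges t.
Proof. by case: t => s; rewrite nb_edges_forest size_forest_degrees. Qed.

(** Reading a degree word from right to left, each letter [d] grafts the [d]
    topmost trees of the stack under a new root. *)
Definition parse (w : seq nat) : seq ptree :=
  foldr (fun d st => PNode (take d st) :: drop d st) [::] w.

Lemma parse_forest_degrees s w : parse (forest_degrees s ++ w) = s ++ parse w.
Proof.
elim/forest_ind: s w => // s r IHs IHr w.
rewrite forest_degrees_cons /= -catA IHs IHr.
by rewrite take_size_cat // drop_size_cat.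
Qed.

Lemma forest_degrees1 t : forest_degrees [:: t] = degrees t.
Proof. exact: cats0. Qed.

Lemma degrees_inj : injective degrees.
Proof.
apply: can_inj (fun w => head (PNode [::]) (parse w)) _ => t.
by rewrite -forest_degrees1 -[forest_degrees _]cats0 parse_forest_degrees.
Qed.

(** The Lukasiewicz condition: every nonempty suffix is longer than its sum. *)
Fixpoint luka (w : seq nat) : bool :=
  if w is d :: u then (d + sumn u <= size u) && luka u else true.

Lemma luka_sumn w : luka w -> sumn w <= size w.
Proof. by case: w => //= d u /andP[]; lia. Qed.

Lemma luka_sumn_lt w : luka w -> 0 < size w -> sumn w < size w.
Proof. by case: w => //= d u /andP[]; lia. Qed.

Lemma luka_cat u v : luka u -> luka v -> luka (u ++ v).
Proof.
move=> + luka_v; elim: u => //= d u IHu /andP[le_d luka_u].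
rewrite IHu // andbT sumn_cat size_cat.
by have := luka_sumn luka_v; lia.
Qed.

Lemma luka_catl u v : luka (v ++ u) -> luka u.
Proof. by elim: v => //= d v IHv /andP[_ /IHv]. Qed.

Lemma luka_drop w :
  (forall j, j < size w -> sumn (drop j w) < size w - j) -> luka w.
Proof.
elim: w => //= d u IHu ltw; have /= := ltw 0 isT; rewrite subn0 ltnS => -> /=.
by apply: IHu => j ltj; have := ltw j.+1 ltj; rewrite /= subSS.
Qed.

Lemma luka_forest_degrees s : luka (forest_degrees s).
Proof.
elim/forest_ind: s => // s r IHs IHr.
rewrite forest_degrees_cons /= luka_cat // andbT sumn_cat size_cat.
by rewrite !size_forest_degrees; lia.
Qed.

Lemma luka_degrees t : luka (degrees t).
Proof. by rewrite -forest_degrees1 luka_forest_degrees. Qed.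

Lemma parseK w : luka w ->
  forest_degrees (parse w) = w /\ size (parse w) = size w - sumn w.
Proof.
elim: w => //= d u IHu /andP[le_d /IHu[def_u sz_u]].
(* The Lukasiewicz condition says exactly that the stack holds at least [d] trees, so [take d] is
   not truncated. *)
have le_ds : d <= size (parse u) by lia.
rewrite forest_degrees_cons size_drop size_takel // sz_u; split; last by lia.
by rewrite -flatten_cat -map_cat cat_take_drop; congr (_ :: _).
Qed.

Lemma luka_degreesP w : luka w -> size w = (sumn w).+1 ->
  exists t, degrees t = w.
Proof.
move=> /parseK[]; case: (parse w) => [|t [|? ?]] /= def_w sz_w szw; try lia.
by exists t; rewrite -def_w forest_degrees1.
Qed.

(** * The cycle lemma *)

Lemma first_min (f : nat -> nat) N : exists2 i, i <= N &
  (forall j, j < i -> f i < f j) /\ (forall j, j <= N -> f i <= f j).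
Proof.
elim: N => [|N [i le_iN [lt_i le_i]]].
  by exists 0 => //; split=> // j; rewrite leqn0 => /eqP->.
have [le_fi | lt_fi] := leqP (f i) (f N.+1).
  exists i; first exact: leqW.
  by split=> // j; rewrite leq_eqVlt => /predU1P[->|/le_i].
exists N.+1 => //; split=> j; first by move=> /le_i; exact: leq_trans.
by rewrite leq_eqVlt => /predU1P[->|/le_i /(leq_trans (ltnW lt_fi))].
Qed.

(** The rotation starts after the first minimum over [j] of the sum of the
    [j] first letters minus [j]; adding [size w] keeps this in [nat]. *)
Lemma luka_rot_exists w : size w = (sumn w).+1 ->
  exists i, luka (rot i w).
Proof.
move=> szw; have sumE j : sumn (take j w) + sumn (drop j w) = sumn w.
  by rewrite -sumn_cat cat_take_drop.
have [i le_i [lt_f le_f]] :=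
  first_min (fun j => sumn (take j w) + (size w - j)) (size w).
exists i; apply: luka_drop => j; rewrite size_rot => lt_j.
rewrite /rot drop_cat size_drop; case: (ltnP j (size w - i)) => le_j.
  (* The suffix starts in [drop i w] and contains all of [take i w]: weak minimality at [j + i] is
     enough, as the total sum is [size w - 1]. *)
  rewrite drop_drop sumn_cat.
  have := le_f (j + i); have := sumE (j + i); lia.
(* The suffix lies inside [take i w]; strictness is needed here, and holds because [i] is the first
   minimum. *)
set j' := j - _; have lt_j' : j' < i by rewrite /j'; lia.
have := lt_f _ lt_j'; have szi : size (take i w) = i by rewrite size_takel.
have : sumn (take i w) = sumn (take j' w) + sumn (drop j' (take i w)).
  rewrite -[LHS](congr1 sumn (cat_take_drop j' _)) sumn_cat.
  by rewrite take_takel // ltnW.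
rewrite /j'; lia.
Qed.

(** If [0 < i], then [drop i w] is a nonempty suffix of [w] and [take i w] one of [rot i w]. Each is
    longer than its sum, so [size w] would exceed [sumn w] by at least 2. *)
Lemma luka_rot_unique w i : size w = (sumn w).+1 -> i < size w ->
  luka w -> luka (rot i w) -> i = 0.
Proof.
case: i => // i szw lt_i luka_w luka_r.
have luka_d : luka (drop i.+1 w).
  by apply: (@luka_catl _ (take i.+1 w)); rewrite cat_take_drop.
have luka_t := luka_catl luka_r.
have := luka_sumn_lt luka_d; have := luka_sumn_lt luka_t.
have : sumn (take i.+1 w) + sumn (drop i.+1 w) = sumn w.
  by rewrite -sumn_cat cat_take_drop.
rewrite size_drop size_takel //; lia.
Qed.

(** Two equal rotations would make [w] invariant under rotation by their difference, against
    uniqueness. *)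
Lemma luka_rot_inj w i j : size w = (sumn w).+1 -> luka w ->
  i < size w -> j < size w -> rot i w = rot j w -> i = j.
Proof.
move=> szw luka_w; wlog le_ij : i j / i <= j => [th|] lt_i lt_j eq_r.
  by case/orP: (leq_total i j) => le; [|symmetry]; apply: th.
have: rot (j - i) w = w.
  apply: (@rot_inj i); rewrite -rotD; last by rewrite subnKC // ltnW.
  by rewrite eq_r subnKC.
move=> eq_w; suff: j - i = 0 by lia.
by apply: (luka_rot_unique szw) => //; [lia | rewrite eq_w].
Qed.

Lemma rot_sym (T : Type) (v w : seq T) i : v = rot i w ->
  exists j, w = rot j v.
Proof.
by move=> ->; exists (size (rot i w) - i); rewrite -[RHS]/(rotr i _) rotK.
Qed.

Lemma luka_rot_eq w i j : size w = (sumn w).+1 ->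
  luka (rot i w) -> luka (rot j w) -> rot i w = rot j w.
Proof.
move=> szw; set v := rot i w => luka_v.
have szv : size v = (sumn v).+1 by rewrite size_rot sumn_rot.
have [l ->] := rot_sym (erefl v); rewrite rot_rot_add.
set h := rot_add _ _ _ => luka_h.
have [le_h | lt_h] := leqP (size v) h; first by rewrite rot_oversize.
by rewrite (luka_rot_unique szv lt_h luka_v luka_h) rot0.
Qed.

(** * Words encoding the pairs *)

Fixpoint fill (b : bitseq) (c : seq nat) : seq nat :=
  match b, c with
  | true :: b', x :: c' => x :: fill b' c'
  | false :: b', _ => 0 :: fill b' c
  | _, _ => [::]
  end.

(** Positive letters stay distinguishable from the inserted zeros, and the count condition keeps
    [fill] from stopping early or dropping letters. *)
Lemma fillK b c : all (fun x => 0 < x) c -> count id b = size c ->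
  [seq 0 < x | x <- fill b c] = b /\ [seq x <- fill b c | 0 < x] = c.
Proof.
elim: b c => [|[] b IHb] [|x c] //=.
- by case/andP=> x_gt0 /IHb{}IHb [/IHb[-> ->]]; rewrite x_gt0.
- by move=> _ /(IHb [::] isT)[-> ->].
- by move=> pos_c /(IHb (x :: c) pos_c)[-> ->].
Qed.

Lemma fill_surj w : fill [seq 0 < x | x <- w] [seq x <- w | 0 < x] = w.
Proof. by elim: w => //= -[|x] w IHw /=; rewrite IHw. Qed.

Lemma sumn_pos w : sumn [seq x <- w | 0 < x] = sumn w.
Proof. by elim: w => //= -[|x] w IHw /=; rewrite IHw. Qed.

Lemma count_pos w :
  count (fun x => 1 < x) [seq x <- w | 0 < x] = count (fun x => 1 < x) w.
Proof. by elim: w => //= -[|x] w IHw /=; rewrite IHw. Qed.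

Definition bits n (A : {set 'I_n}) : bitseq := [seq i \in A | i <- enum 'I_n].

Lemma size_bits n (A : {set 'I_n}) : size (bits A) = n.
Proof. by rewrite size_map size_enum_ord. Qed.

Lemma nth_bits n (A : {set 'I_n}) (i : 'I_n) : nth false (bits A) i = (i \in A).
Proof. by rewrite (nth_map i) ?size_enum_ord // nth_ord_enum. Qed.

Lemma count_bits n (A : {set 'I_n}) : count id (bits A) = #|A|.
Proof. by rewrite count_map cardE -size_filter enumT. Qed.

Lemma bits_inj n : injective (@bits n).
Proof. by move=> A B eqAB; apply/setP=> i; rewrite -!nth_bits eqAB. Qed.

Lemma bits_surj n b : size b = n -> exists A : {set 'I_n}, bits A = b.
Proof.
move=> szb; exists [set i : 'I_n | nth false b i].
apply: (@eq_from_nth _ false); rewrite size_bits // => i lt_in.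
by rewrite -[i]/(val (Ordinal lt_in)) nth_bits inE.
Qed.

Definition word n (x : {set 'I_n} * composition n) : seq nat :=
  fill (true :: bits x.1) x.2.

(** The image of [UComp n k m] under [word]; the condition on the head reflects the forced leading
    [true]. *)
Definition words n k m : pred (seq nat) := fun w =>
  [&& size w == n.+1, sumn w == n, count (fun x => 0 < x) w == k,
      count (fun x => 1 < x) w == m & 0 < head 0 w].

Lemma composition_pos n (c : composition n) : all (fun x => 0 < x) c.
Proof. by case/andP: (valP c). Qed.

Lemma sumn_composition n (c : composition n) : sumn c = n.
Proof. by case/andP: (valP c) => _ /eqP. Qed.

(** * The map and its fibres *)

Section Words.

Variables (n k m : nat).
Hypothesis k_gt0 : 0 < k.

Lemma UComp_fillK x : x \in UComp n k m ->
  [seq 0 < a | a <- word x] = true :: bits x.1 /\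
  [seq a <- word x | 0 < a] = x.2.
Proof.
rewrite inE => /and3P[/eqP cardA /eqP sz_c _].
apply: fillK; first exact: composition_pos.
by rewrite /= count_bits cardA sz_c; lia.
Qed.

Lemma word_inj : {in UComp n k m &, injective (@word n)}.
Proof.
move=> x y /UComp_fillK[bx cx] /UComp_fillK[b_y cy] eq_xy.
move: bx cx; rewrite eq_xy b_y cy {b_y cy eq_xy}.
by case: x y => [A c] [B d] /= [/bits_inj->] /val_inj->.
Qed.

Lemma word_words x : x \in UComp n k m -> words n k m (word x).
Proof.
move=> Ux; have [bx cx] := UComp_fillK Ux.
move: Ux; rewrite inE => /and3P[/eqP cardA /eqP sz_c /eqP cnt_c].
apply/and5P; split.
- by rewrite -(size_map (fun a => 0 < a)) bx /= size_bits.
- by rewrite -sumn_pos cx sumn_composition.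
- by rewrite -size_filter cx sz_c.
- by rewrite -count_pos cx cnt_c.
- by case: (word x) bx => //= a w [->].
Qed.

Lemma words_word w : words n k m w -> exists2 x, x \in UComp n k m & word x = w.
Proof.
case: w => [|a w] /and5P[/eqP szw /eqP sumw /eqP cntw /eqP cntw2] //= a_gt0.
have [|A bitsA] := @bits_surj n [seq 0 < x | x <- w].
  by rewrite size_map; case: szw.
have compc : is_composition n [seq x <- a :: w | 0 < x].
  by rewrite /is_composition filter_all sumn_pos sumw eqxx.
exists (A, Composition compc); last first.
  by rewrite /word bitsA -[RHS]fill_surj /= a_gt0.
rewrite inE -[X in size X]/[seq x <- a :: w | 0 < x].
rewrite -[X in count _ X]/[seq x <- a :: w | 0 < x].
rewrite count_pos cntw2 size_filter cntw !eqxx !andbT.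
rewrite -count_bits bitsA count_map.
by move: cntw; rewrite /= a_gt0 => <-; rewrite add1n subn1.
Qed.

Lemma words_rot_degrees w : words n k m w ->
  exists2 t, t \in Trees n k m & exists i, rot i w = degrees (val t).
Proof.
case/and5P=> /eqP szw /eqP sumw /eqP cntw /eqP cntw2 _.
have szwS : size w = (sumn w).+1 by rewrite szw sumw.
have [i luka_i] := luka_rot_exists szwS.
have [|t def_t] := luka_degreesP luka_i; first by rewrite size_rot sumn_rot.
have edges_t : nb_edges t == n by rewrite -sumn_degrees def_t sumn_rot sumw.
exists (PlaneTree edges_t); last by exists i.
rewrite inE /nb_internal /nb_branching /= def_t.
have /permP pr : perm_eq (rot i w) w by rewrite perm_rot.
by rewrite !pr cntw cntw2 !eqxx.
Qed.

Lemma rot_degrees_inj w i j t u :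
  rot i w = degrees t -> rot j w = degrees u -> t = u.
Proof.
move=> eq_t eq_u; apply: degrees_inj; rewrite -eq_t -eq_u.
apply: luka_rot_eq; rewrite ?eq_t ?eq_u ?luka_degrees //.
by rewrite -(size_rot i) -(sumn_rot _ i) eq_t size_degrees sumn_degrees.
Qed.

(** Lists the words lying over [t] explicitly, so that a fibre can be counted through start
    positions in the degree word. *)
Lemma words_rotP w t : t \in Trees n k m ->
  (words n k m w /\ exists i, rot i w = degrees (val t)) <->
  w \in [seq rot i (degrees (val t))
        | i <- iota 0 n.+1 & 0 < nth 0 (degrees (val t)) i].
Proof.
rewrite inE => /andP[/eqP int_t /eqP br_t].
have szt : size (degrees (val t)) = n.+1.
  by rewrite size_degrees (eqP (valP t)).
have sumt : sumn (degrees (val t)) = n by rewrite sumn_degrees (eqP (valP t)).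
have head_rot i : i < n.+1 ->
  head 0 (rot i (degrees (val t))) = nth 0 (degrees (val t)) i.
  by move=> lt_i; rewrite /rot (drop_nth 0) // szt.
split=> [[Ww [i /esym/rot_sym[j def_w]]]|/mapP[i]].
  have [l lt_l def_l] : exists2 l, l < n.+1 & w = rot l (degrees (val t)).
    have [lt_j|le_j] := ltnP j n.+1; first by exists j.
    by exists 0 => //; rewrite rot0 def_w rot_oversize // szt.
  apply/mapP; exists l => //; rewrite mem_filter mem_iota lt_l -head_rot //.
  by rewrite -def_l; case/and5P: Ww => _ _ _ _ ->.
rewrite mem_filter mem_iota => /andP[nz_i lt_i] ->; split; last first.
  by have [j /esym] := rot_sym (erefl (rot i (degrees (val t)))); exists j.
apply/and5P; split; last by rewrite head_rot.
- by rewrite size_rot szt.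
- by rewrite sumn_rot sumt.
- by have /permP-> := permEl (perm_rot i (degrees (val t))); apply/eqP.
- by have /permP-> := permEl (perm_rot i (degrees (val t))); apply/eqP.
Qed.

(** The duplicate-free lists [s1] (words of the fibre) and [s2] (rotations starting at a nonzero
    letter) have the same members; the size of [s2] is the number of internal nodes. *)
Lemma card_fibre (phi : {x | x \in UComp n k m} -> {t | t \in Trees n k m}) :
    (forall x, exists i, rot i (word (val x)) = degrees (val (val (phi x)))) ->
  forall t, #|[set x | phi x == t]| = k.
Proof.
move=> phiP t; set L := degrees (val (val t)).
have szL : size L = n.+1 by rewrite size_degrees (eqP (valP (val t))).
have sumL : sumn L = n by rewrite sumn_degrees (eqP (valP (val t))).
pose s1 := [seq word (val x) | x <- enum [set x | phi x == t]].
pose s2 := [seq rot i L | i <- iota 0 n.+1 & 0 < nth 0 L i].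
have uniq1 : uniq s1.
  rewrite map_inj_uniq ?enum_uniq // => x y eq_xy; apply: val_inj.
  by apply: word_inj eq_xy; apply: valP.
have uniq2 : uniq s2.
  rewrite map_inj_in_uniq ?filter_uniq ?iota_uniq // => i j.
  rewrite !mem_filter !mem_iota => /andP[_ lt_i] /andP[_ lt_j].
  by apply: luka_rot_inj; rewrite ?szL ?sumL ?luka_degrees.
have eq_s : s1 =i s2.
  move=> w; apply/idP/idP.
    case/mapP=> x; rewrite mem_enum inE => /eqP def_t ->.
    apply/words_rotP; first exact: valP.
    by split; [apply: word_words; apply: valP | rewrite -def_t].
  case/words_rotP; first exact: valP.
  move=> /words_word[x Ux <-] [i eq_i]; apply/mapP.
  exists (Sub x Ux) => //; rewrite mem_enum inE; apply/eqP/val_inj/val_inj.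
  by have [j eq_j] := phiP (Sub x Ux); apply: rot_degrees_inj eq_j eq_i.
have := perm_size (uniq_perm uniq1 uniq2 eq_s).
rewrite !size_map -cardE => ->; rewrite size_filter -szL.
have <- : nb_internal (val (val t)) = k.
  by have := valP t; rewrite inE => /andP[/eqP].
by rewrite /nb_internal -/L -[in RHS](mkseq_nth 0 L) count_map.
Qed.

Lemma exists_UComp_to_Trees :
  exists phi : {x | x \in UComp n k m} -> {t | t \in Trees n k m},
    forall t, #|[set x | phi x == t]| = k.
Proof.
have [|phi phiP] := @fin_all_exists {x | x \in UComp n k m}
  (fun=> {t | t \in Trees n k m})
  (fun x t => exists i, rot i (word (val x)) = degrees (val (val t))).
  move=> x; have [t Tt [i eq_i]] := words_rot_degrees (word_words (valP x)).
  by exists (Sub t Tt), i.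
by exists phi; apply: card_fibre.
Qed.

End Words.

(** * Counting the pairs *)

Lemma card_fibres (T U : finType) (f : T -> U) k :
  (forall u, #|[set x | f x == u]| = k) -> #|T| = #|U| * k.
Proof.
move=> fk; rewrite -sum1_card (partition_big f xpredT) //=.
rewrite (eq_bigr (fun=> k)) ?sum_nat_const // => u _.
by rewrite sum1dep_card fk.
Qed.

(** Here [d] is the excess of the sum over the number [k] of parts. A first part larger than 1
    leaves excess [e < d] to the others. *)
Fixpoint compositions (k d m : nat) : seq (seq nat) :=
  match k, m with
  | 0, _ => if (d == 0) && (m == 0) then [:: [::]] else [::]
  | k'.+1, 0 => map (cons 1) (compositions k' d 0)
  | k'.+1, m'.+1 => map (cons 1) (compositions k' d m) ++
      [seq (d - e).+1 :: c | e <- iota 0 d, c <- compositions k' e m']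
  end.

Lemma size_le_sumn c : all (fun x => 0 < x) c -> size c <= sumn c.
Proof. by elim: c => //= x c IHc /andP[x_gt0 /IHc]; lia. Qed.

Lemma mem_compositions k d m c : (c \in compositions k d m) =
  [&& all (fun x => 0 < x) c, size c == k, sumn c == k + d
    & count (fun x => 1 < x) c == m].
Proof.
elim: k d m c => [|k IHk] d m c.
  case: c => [|x c] /=; last by rewrite andbF; case: ifP.
  by rewrite !(eq_sym 0); case: eqP => //; case: eqP.
have memS (u : seq (seq nat)) : ([::] \in map (cons 1) u) = false.
  by apply/mapP=> -[].
have mem1 x c' (u : seq (seq nat)) :
    (x :: c' \in map (cons 1) u) = (x == 1) && (c' \in u).
  apply/mapP/andP=> [[v uv [-> ->]]|[/eqP-> uc]]; first by rewrite eqxx.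
  by exists c'.
case: m => [|m]; case: c => [|x c] /=.
- by rewrite memS.
- by rewrite mem1 IHk; case: x => [|[|x]] //=; rewrite ?andbF //; lia.
- by rewrite mem_cat memS; apply/allpairsPdep=> -[? [? []]].
rewrite mem_cat mem1 IHk.
have -> :
  (x :: c \in [seq (d - e).+1 :: c0
              | e <- iota 0 d, c0 <- compositions k e m]) =
  [&& 1 < x, x <= d.+1 & c \in compositions k (d.+1 - x) m].
  apply/allpairsPdep/and3P => [[e [c0 [+ cc [-> ->]]]]|[x_gt1 le_x cc]].
    rewrite mem_iota => lt_e; split; [lia | lia |].
    by have -> : d.+1 - (d - e).+1 = e by lia.
  exists (d.+1 - x), c; split=> //; first by rewrite mem_iota; lia.
  by congr (_ :: _); lia.
(* The tail sums to at least its size [k], which yields the bound [x <= d.+1] from the total sum. *)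
rewrite IHk; have := @size_le_sumn c.
by case: x => [|[|x]] //=; case: (all _ c) => [/(_ isT)|_] //=; lia.
Qed.

Lemma uniq_compositions k d m : uniq (compositions k d m).
Proof.
have cons_inj (x : nat) : injective (cons x) by move=> u v [].
elim: k d m => [|k IHk] d [|m] //=; try by case: ifP.
  by rewrite (map_inj_uniq (@cons_inj 1)).
rewrite cat_uniq (map_inj_uniq (@cons_inj 1)) IHk /=; apply/andP; split.
  apply/hasPn=> _ /allpairsPdep[e [c [+ cc ->]]]; rewrite mem_iota => lt_e.
  by apply/mapP=> -[? _ [eq1]]; lia.
set f := fun e c => (d - e).+1 :: c.
apply: (@allpairs_uniq_dep _ (fun=> seq nat) _ f); rewrite ?iota_uniq //.
move=> p q /allpairsPdep[e [c [+ _ ->]]] /allpairsPdep[e' [c' [+ _ ->]]].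
rewrite !mem_iota /f /= => lt_e lt_e' [eq_e ->].
by have -> : e = e' by lia.
Qed.

(** The number of compositions of [d] into [m] positive parts, boundary cases included. *)
Definition nb_compositions (d m : nat) : nat :=
  match d, m with
  | 0, _ => m == 0
  | d'.+1, 0 => 0
  | d'.+1, m'.+1 => 'C(d', m')
  end.

(** Removing one part from a composition of [d] leaves a composition of some [e < d]; formally,
    Pascal's rule summed up. *)
Lemma sum_nb_compositions d m :
  \sum_(0 <= e < d) nb_compositions e m = nb_compositions d m.+1.
Proof.
elim: d => [|d IHd]; first by rewrite big_geq.
rewrite big_nat_recr //= IHd.
case: d {IHd} => [|d] /=; first by case: m.
by case: m => [|m]; rewrite ?bin0 // binS.
Qed.

(** Choose which [m] parts exceed 1, then distribute the excess [d] over them. The induction is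
    Pascal's rule, according to whether the first part is 1. *)
Lemma size_compositions k d m :
  size (compositions k d m) = nb_compositions d m * 'C(k, m).
Proof.
elim: k d m => [|k IHk] d m.
  by case: d m => [|d] [|m]; rewrite /= ?bin0n ?muln0.
case: m => [|m] /=; first by rewrite size_map IHk !bin0.
rewrite size_cat size_map IHk size_allpairs_dep binS mulnDr; congr (_ + _).
rewrite sumnE big_map (eq_bigr (fun e => nb_compositions e m * 'C(k, m))).
  by rewrite -big_distrl /= -sum_nb_compositions /index_iota subn0.
by move=> e _; rewrite IHk.
Qed.

Lemma card_compositions n k m : k <= n ->
  #|[set c : composition n | (size c == k) && (count (fun p => 1 < p) c == m)]|
  = nb_compositions (n - k) m * 'C(k, m).
Proof.
move=> le_kn; rewrite -size_compositions cardE -(size_map val).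
apply: perm_size; apply: uniq_perm; rewrite ?uniq_compositions //.
  by rewrite (map_inj_uniq val_inj) enum_uniq.
move=> c; rewrite mem_compositions subnKC //; apply/mapP/and4P.
  case=> c0; rewrite mem_enum inE => /andP[sz_c cnt_c] -> /=.
  by rewrite composition_pos sumn_composition eqxx.
case=> pos_c sz_c sum_c cnt_c.
have comp_c : is_composition n c by rewrite /is_composition pos_c.
by exists (Composition comp_c); rewrite // mem_enum inE sz_c.
Qed.

Lemma card_UComp n k m : 0 < m -> k < n ->
  #|UComp n k m| = 'C(n, k - 1) * ('C(n - k - 1, m - 1) * 'C(k, m)).
Proof.
move=> m_gt0 lt_kn.
(* Both [n - k] and [m] are positive, so the boundary cases do not occur. *)
have -> : 'C(n - k - 1, m - 1) = nb_compositions (n - k) m.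
  case: m m_gt0 => // m _; case def_d: (n - k) => [|d]; first by lia.
  by rewrite !subn1.
rewrite -card_compositions 1?ltnW // -[X in 'C(X, _)]card_ord -card_draws.
rewrite -cardsX; apply: eq_card => -[A c].
by rewrite !inE.
Qed.

Theorem theorem3p2 (n k m : nat) (hm : 1 <= m) (hmk : m <= k) (hkn : k + m <= n) :
  (exists phi : {x | x \in UComp n k m} -> {t | t \in Trees n k m},
     forall t : {t | t \in Trees n k m}, #|[set x | phi x == t]| = k)
  /\ (#|Trees n k m|%:R = k%:R^-1 * #|UComp n k m|%:R :> rat)%R
  /\ (k%:R^-1 * #|UComp n k m|%:R =
      k%:R^-1 * 'C(n, k - 1)%:R * 'C(n - k - 1, m - 1)%:R * 'C(k, m)%:R :> rat)%R.
Proof.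
have k_gt0 : 0 < k by exact: leq_trans hmk.
have [phi phiP] := exists_UComp_to_Trees n m k_gt0.
split; first by exists phi.
have cardU : #|UComp n k m| = #|Trees n k m| * k.
  by have := card_fibres phiP; rewrite !card_sig.
split; last by rewrite card_UComp ?natrM ?mulrA //; lia.
rewrite cardU natrM mulrC mulfK // pnatr_eq0; lia.
Qed.
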